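(* Let $\mathbb{P}$ be a set of probability distributions on $(\mathcal{Z},\mathcal{B})$ and let $\mathbb{P}_0,\mathbb{P}_1$ be a partition of $\mathbb{P}$ into nonempty sets. Assume that for every $Q\in\mathbb{P}_1$ there exists a sequence $\{P_k\}_{k=1}^\infty$ in $co(\mathbb{P}_0)$ such that $P_k$ converges in distribution to $Q$. Then every test $\phi:\mathcal{Z}\to[0,1]$ that is almost surely continuous under every $Q\in\mathbb{P}_1$ has power limited by size, i.e. $$\sup_{Q\in\mathbb{P}_1}\mathbb{E}_Q[\phi]\le\sup_{P\in\mathbb{P}_0}\mathbb{E}_P[\phi].$$
   Context: $\mathcal{Z}$ is a subset of the Euclidean space $\mathbb{R}^{n\times l}$ with Borel $\sigma$-algebra $\mathcal{B}$. All distributions in $\mathbb{P}$ are assumed absolutely continuous with respect to one common $\sigma$-finite measure. A test is a measurable function $\phi:\mathcal{Z}\to[0,1]$; $\mathbb{E}_P[\phi]=\int\phi\,dP$. A test is a.s. continuous under $Q$ if the set of its discontinuity points has $Q$-probability zero. For a set $\mathbb{P}'$ of distributions, $co(\mathbb{P}')$ is its convex hull, i.e. the set of all finite mixtures $\sum_{i=1}^N\alpha_iP_i$ with $N\in\mathbb{N}$, $P_i\in\mathbb{P}'$, $\alpha_i\in[0,1]$, $\sum_i\alpha_i=1$. Convergence in distribution is weak convergence of probability measures on $\mathcal{Z}$ (equivalently, $P_k(B)\to Q(B)$ for every Borel $B$ with $Q(\partial B)=0$). *)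

(* Defs.v *)
From HB Require Import structures.
From mathcomp Require Import all_boot all_order all_algebra.
From mathcomp Require Import all_classical all_reals all_analysis.

Set Implicit Arguments.
Unset Strict Implicit.
Unset Printing Implicit Defensive.

Import Order.TTheory GRing.Theory Num.Theory.
Import numFieldNormedType.Exports.

Local Open Scope classical_set_scope.
Local Open Scope ring_scope.

(* [set_type Z] with its subspace topology and the sigma-algebra generated by
   the relatively open sets. [measurableType] requires a point, hence the
   argument [Z0]; it costs no generality, as there is no probability measure on
   the empty set. [Z] itself need not be a Borel set. *)
Definition sample_space (R : realType) (n l : nat) (Z : set 'M[R]_(n, l))
  (Z0 : Z !=set0) : Type := set_type Z.

Section sample_space_instances.
Context (R : realType) (n l : nat) (Z : set 'M[R]_(n, l)) (Z0 : Z !=set0).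

HB.instance Definition _ := PseudoMetric.copy (sample_space Z0) (set_type Z).

HB.instance Definition _ := isPointed.Build (sample_space Z0)
  (exist _ (projT1 (cid Z0)) (mem_set (projT2 (cid Z0)))).

HB.instance Definition _ := Measurable.copy (sample_space Z0)
  (g_sigma_algebraType (@open (sample_space Z0))).

End sample_space_instances.

Section definitions.
Context (R : realType) (n l : nat) (Z : set 'M[R]_(n, l)) (Z0 : Z !=set0).
Local Notation T := (sample_space Z0).

Definition is_test (phi : T -> R) : Prop :=
  measurable_fun [set: T] phi /\ forall z, 0 <= phi z <= 1.

(* The discontinuity set of a real function is Borel, so its negligibility means
   that its [Q]-probability is zero. *)
Definition as_continuous (Q : probability T R) (phi : T -> R) : Prop :=
  Q.-negligible [set z | ~ {for z, continuous phi}].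

(* The mixture is compared with [P] on measurable sets only: the value of a
   measure on the other sets is irrelevant. *)
Definition co (PP : set (probability T R)) : set (probability T R) :=
  [set P | exists (N : nat) (alpha : 'I_N -> R) (Ps : 'I_N -> probability T R),
    [/\ forall i, PP (Ps i),
        forall i, 0 <= alpha i <= 1,
        \sum_(i < N) alpha i = 1 &
        forall A, measurable A ->
          P A = (\sum_(i < N) (alpha i)%:E * Ps i A)%E] ].

Definition cvg_in_distribution (P_ : nat -> probability T R)
    (Q : probability T R) : Prop :=
  forall f : T -> R, continuous f -> bounded_fun f ->
    ('E_(P_ k)[f])%E @[k --> \oo] --> ('E_Q[f])%E.

End definitions.

(* Main.v *)
Require Import Defs.
From HB Require Import structures.
From mathcomp Require Import all_boot all_order all_algebra.
From mathcomp Require Import all_classical all_reals all_analysis.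
From mathcomp Require Import measurable_realfun.

Set Implicit Arguments.
Unset Strict Implicit.
Unset Printing Implicit Defensive.

Import Order.TTheory GRing.Theory Num.Theory.
Import numFieldNormedType.Exports.

Local Open Scope classical_set_scope.
Local Open Scope ring_scope.

(* A bounded nonnegative [phi] dominates its Lipschitz envelopes
   [phi_j x = inf_y (phi y + j d(x, y))], which are bounded and continuous and
   converge to [phi] at every continuity point of [phi]. For each [j],
   [E_Q phi_j = lim_k E_(P_k) phi_j <= sup_k E_(P_k) phi], and each [E_(P_k) phi],
   an average of expectations under members of [P0], is at most the size.
   Dominated convergence in [j] transfers the bound to [E_Q phi]. *)

Section lipschitz_envelope.
Context (R : realType) (T : metricType R) (f : T -> R).
Hypothesis f_ge0 : forall x, 0 <= f x.

(* Pasch-Hausdorff envelope: the largest [c]-Lipschitz minorant of [f]. *)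
Definition lipschitz_envelope (c : R) (x : T) : R :=
  inf [set f y + c * mdist x y | y in [set: T]].

Local Notation env := lipschitz_envelope.

(** Nonnegativity of [f] bounds the competitors from below, so [inf] is a true infimum and not its
    default value. *)
Let env_lbound c x : 0 <= c ->
  lbound [set f y + c * mdist x y | y in [set: T]] 0.
Proof. by move=> c0 _ [y _ <-]; rewrite addr_ge0// mulr_ge0// mdist_ge0. Qed.

Lemma le_lipschitz_envelope c x a :
  (forall y, a <= f y + c * mdist x y) -> a <= env c x.
Proof.
move=> ha; apply: lb_le_inf; first by exists (f x + c * mdist x x), x.
by move=> _ [y _ <-].
Qed.

Lemma lipschitz_envelope_ge0 c x : 0 <= c -> 0 <= env c x.
Proof.
move=> c0; apply: le_lipschitz_envelope => y.
by rewrite addr_ge0// mulr_ge0// mdist_ge0.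
Qed.

Lemma lipschitz_envelope_leD c x y : 0 <= c -> env c x <= f y + c * mdist x y.
Proof. by move=> c0; apply: ge_inf; [exists 0; exact: env_lbound|exists y]. Qed.

Lemma lipschitz_envelope_le c x : 0 <= c -> env c x <= f x.
Proof.
move=> c0; have := lipschitz_envelope_leD x x c0.
by rewrite mdistxx mulr0 addr0.
Qed.

(** By the triangle inequality, moving the base point from [y] to [x] raises the penalty of each
    competitor by at most [c * mdist x y]. *)
Lemma lipschitz_envelope_lipschitz c x y : 0 <= c ->
  env c x <= env c y + c * mdist x y.
Proof.
move=> c0; rewrite -lerBlDr; apply: le_lipschitz_envelope => z.
rewrite lerBlDr -addrA -mulrDr (le_trans (lipschitz_envelope_leD x z c0))//.
by rewrite lerD2l ler_wpM2l// addrC metric_triangle.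
Qed.

Lemma lipschitz_envelope_continuous c : 0 <= c -> continuous (env c).
Proof.
move=> c0 x; apply/cvgrPdist_le => e e0.
(* The radius is [e / (c + 1)] rather than [e / c] because [c] may be zero. *)
have c1 : 0 < c + 1 by rewrite ltr_wpDl.
have r0 : 0 < e / (c + 1) by rewrite divr_gt0.
near=> y.
have : mdist x y < e / (c + 1).
  suff : ball x (e / (c + 1)) y by rewrite ballEmdist.
  by near: y; exact: nbhsx_ballx.
rewrite ltr_pdivlMr// mulrC mulrDl mul1r => cde.
have {}cde : c * mdist x y <= e.
  by rewrite (le_trans _ (ltW cde))// lerDl mdist_ge0.
rewrite ler_norml lerNl opprB !lerBlDl; apply/andP; split.
  rewrite (le_trans (lipschitz_envelope_lipschitz y x c0))// lerD2l.
  by rewrite metric_sym.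
by rewrite (le_trans (lipschitz_envelope_lipschitz x y c0))// lerD2l.
Unshelve. all: by end_near. Qed.

(** Competitors within [r] of [x] have value at least [f x - e] by continuity; those farther away
    pay at least [j * r], which exceeds [f x - e] once [j >= f x / r]. *)
Lemma cvg_lipschitz_envelope x : {for x, continuous f} ->
  env j%:R x @[j --> \oo] --> f x.
Proof.
move=> fx; apply/cvgrPdist_le => e e0.
have /nbhs_ballP[r /= r0 fr] : \forall y \near x, f x - e <= f y.
  have /cvgrPdist_le/(_ e e0) := fx; apply: filterS => y.
  by rewrite ler_norml => /andP[_]; rewrite lerBlDr -lerBlDl.
near=> j.
have jr : f x <= j%:R * r.
  by rewrite -ler_pdivrMr//; near: j; exact: nbhs_infty_ger.
rewrite ger0_norm ?subr_ge0 ?lipschitz_envelope_le//.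
rewrite lerBlDr -lerBlDl; apply: le_lipschitz_envelope => y.
have [xyr|rxy] := ltP (mdist x y) r.
  rewrite (le_trans (fr y _)) ?ballEmdist//.
  by rewrite lerDl mulr_ge0// mdist_ge0.
rewrite (@le_trans _ _ (f x))// ?gerBl ?(ltW e0)//.
by rewrite (le_trans jr)// ler_wpDl// ler_wpM2l.
Unshelve. all: by end_near. Qed.

End lipschitz_envelope.

Section sample_space_metric.
Context (R : realType) (n l : nat) (Z : set 'M[R]_(n, l)) (Z0 : Z !=set0).
Local Notation T := (sample_space Z0).

(** This metric has the balls of the existing pseudometric, so continuity of the envelopes refers to
    the subspace topology of [T]. *)
Let dist (x y : T) : R := `|val x - val y|.

Let dist_ge0 x y : 0 <= dist x y. Proof. exact: normr_ge0. Qed.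

Let dist_positivity x y : dist x y = 0 -> x = y.
Proof. by move/normr0_eq0/eqP; rewrite subr_eq0 => /eqP/val_inj. Qed.

Let ballE (x : T) (e : R) : ball x e = [set y | dist x y < e].
Proof.
change (val @^-1` ball (val x) e = [set y : T | dist x y < e]).
by rewrite -ball_normE.
Qed.

HB.instance Definition _ := PseudoMetric_isMetric.Build R T
  dist_ge0 dist_positivity ballE.

Lemma continuous_measurable_sample_space (f : T -> R) :
  continuous f -> measurable_fun [set: T] f.
Proof.
move=> /continuousP cf; apply: (measurability _ (RGenOpens.measurableE R)).
move=> _ [_ [a [b ->] <-]]; rewrite setTI; apply: sub_sigma_algebra.
by apply: cf; exact: interval_open.
Qed.

Lemma expectation_co_le (PP : set (probability T R)) (P : probability T R)
    (phi : T -> R) (s : \bar R) :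
    measurable_fun [set: T] phi -> (forall z, 0 <= phi z) ->
    (forall P', PP P' -> 'E_P'[phi] <= s)%E ->
  co PP P -> ('E_P[phi] <= s)%E.
Proof.
move=> mphi phi0 hs [N [alpha [Ps [PPs alpha01 alpha1 PE]]]].
have alpha0 i : 0 <= alpha i by case/andP: (alpha01 i).
have mphi' : measurable_fun [set: T] (EFin \o phi) by exact/measurable_EFinP.
(* [msum] takes a family indexed by [nat]: the weighted components are extended by the zero measure
   from [N] on. *)
pose m i : {measure set T -> \bar R} :=
  if insub i is Some j then mscale (NngNum (alpha0 j)) (Ps j) else mzero.
rewrite unlock (eq_measure_integral (msum m N)); last first.
  move=> A mA _; apply: etrans (PE A mA) _; rewrite /msum/=.
  apply: eq_bigr => i _.
  by rewrite /m valK.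
rewrite ge0_integral_measure_sum//; last by move=> z _; rewrite lee_fin.
(* The weights are nonnegative with sum 1, so this holds even for infinite [s], and the sums compare
   termwise. *)
have -> : s = (\sum_(i < N) (alpha i)%:E * s)%E.
  rewrite -ge0_sume_distrl; last by move=> i _; rewrite lee_fin.
  by rewrite sumEFin alpha1 mul1e.
apply: lee_sum => i _; rewrite /m valK ge0_integral_mscale//=.
- by rewrite lee_wpmul2l ?lee_fin//; have := hs _ (PPs i); rewrite unlock.
- by move=> z _; rewrite lee_fin.
Qed.

Lemma cvg_expectation_lipschitz_envelope (Q : probability T R) (phi : T -> R) :
    is_test phi -> as_continuous Q phi ->
  'E_Q[lipschitz_envelope phi j%:R]%E @[j --> \oo] --> 'E_Q[phi]%E.
Proof.
move=> [mphi phi01] Qphi.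
have phi0 z : 0 <= phi z by case/andP: (phi01 z).
rewrite unlock.
have [] := @dominated_convergence _ T R Q setT measurableT
  (fun j z => (lipschitz_envelope phi j%:R z)%:E) (EFin \o phi) (cst 1%E) => //.
- move=> j; apply/measurable_EFinP; apply: continuous_measurable_sample_space.
  exact: lipschitz_envelope_continuous.
- exact/measurable_EFinP.
(* Convergence can fail only at discontinuity points of [phi]. *)
- apply: negligibleS Qphi => z /=; apply: contra_not => cz _.
  by apply: cvg_EFin; [exact: nearW|exact: cvg_lipschitz_envelope].
- apply/integrableP; split; first exact: measurable_cst.
  by rewrite integral_cst//= normr1 mul1e probability_setT ltry.
- apply: aeW => z j _; rewrite lee_fin ger0_norm ?lipschitz_envelope_ge0//.
  rewrite (le_trans (lipschitz_envelope_le phi0 z _))//.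
  by case/andP: (phi01 z).
Qed.

End sample_space_metric.

Theorem theorem2 (R : realType) (n l : nat) (Z : set 'M[R]_(n, l))
    (Z0 : Z !=set0)
    (PP P0 P1 : set (probability (sample_space Z0) R))
    (dominated : exists mu : {sigma_finite_measure set (sample_space Z0) -> \bar R},
      forall P, PP P -> P `<< mu)
    (P0_neq0 : P0 !=set0) (P1_neq0 : P1 !=set0)
    (cover : P0 `|` P1 = PP) (disjoint : P0 `&` P1 = set0)
    (approx : forall Q, P1 Q ->
      exists P_ : nat -> probability (sample_space Z0) R,
        (forall k, co P0 (P_ k)) /\ cvg_in_distribution P_ Q)
    (phi : sample_space Z0 -> R)
    (phi_test : is_test phi)
    (phi_cont : forall Q, P1 Q -> as_continuous Q phi) :
  (ereal_sup [set 'E_Q[phi] | Q in P1] <= ereal_sup [set 'E_P[phi] | P in P0])%E.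
Proof.
have [mphi phi01] := phi_test.
have phi0 z : 0 <= phi z by case/andP: (phi01 z).
apply: ge_ereal_sup => _ [Q P1Q <-].
have [P_ [coP_ P_Q]] := approx Q P1Q.
apply: cvge_to_le (cvg_expectation_lipschitz_envelope phi_test (phi_cont Q P1Q)) _.
apply: nearW => j.
have env_cont : continuous (lipschitz_envelope phi j%:R).
  exact: lipschitz_envelope_continuous.
have env0 z : 0 <= lipschitz_envelope phi j%:R z.
  exact: lipschitz_envelope_ge0.
have env_phi z : lipschitz_envelope phi j%:R z <= phi z.
  exact: lipschitz_envelope_le.
(* With [j] fixed, weak convergence applies to the envelope, though not to [phi] itself. *)
apply: cvge_to_le (P_Q _ env_cont _) _.
  exists 1; split => // M M1 z _ /=; rewrite ger0_norm//.
  rewrite (le_trans (env_phi z))// (le_trans _ (ltW M1))//.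
  by case/andP: (phi01 z).
apply: nearW => k; apply: (@le_trans _ _ 'E_(P_ k)[phi]%E).
  apply: expectation_le => //; last exact: aeW.
  exact: continuous_measurable_sample_space.
apply: expectation_co_le (coP_ k) => // P P0P.
by apply: ereal_sup_ubound; exists P.
Qed.
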